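(* There is a set $X$ and a subset $S$ of $\mathbb{U}^{\circ}X$ which is $\delta$-closed but not Lindelöf (as a subspace of $\mathbb{U}X$ with its Stone topology).
   Context: $\mathbb{U}X$ is the set of all ultrafilters on $X$, with the Stone topology $\beta$, having as a base the sets $\beta A=\{\mathcal{U}\in\mathbb{U}X:A\in\mathcal{U}\}$, $A\subset X$. $\mathbb{U}^\circ X\subset\mathbb{U}X$ is the set of free (non-principal) ultrafilters. A subset of $\mathbb{U}X$ is $\delta$-closed if it is closed for the $G_\delta$-topology of $(\mathbb{U}X,\beta)$, that is, the topology on $\mathbb{U}X$ having the $G_\delta$-subsets of $(\mathbb{U}X,\beta)$ as a base. Lindelöf means every open cover has a countable subcover (no separation axiom is included). *)

(* Defs.v *)
From HB Require Import structures.
From mathcomp Require Import all_boot all_order all_algebra.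
From mathcomp Require Import all_classical all_reals all_analysis.
From mathcomp Require Import borel_hierarchy.

Set Implicit Arguments.
Unset Strict Implicit.
Unset Printing Implicit Defensive.

Local Open Scope classical_set_scope.

Record ultrafilter (X : Type) := Ultrafilter {
  ultra_sets :> set_system X;
  ultra_setsP : UltraFilter ultra_sets
}.

Definition free_ultrafilter (X : Type) : set (ultrafilter X) :=
  [set U | ~ exists x : X, ultra_sets U = principal_filter x].

Definition stone_base (X : Type) (A : set X) : set (ultrafilter X) :=
  [set U | ultra_sets U A].

HB.instance Definition _ (X : Type) := gen_eqMixin (ultrafilter X).
HB.instance Definition _ (X : Type) := gen_choiceMixin (ultrafilter X).

Section StoneTopology.
Variable X : Type.

Let stone_cover : \bigcup_(A in [set: set X]) stone_base A = setT.
Proof.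
rewrite -subTset => U _; exists setT => //=.
by have UF := ultra_setsP U; exact: filterT.
Qed.

Let stone_join (A B : set X) (U : ultrafilter X) :
    [set: set X] A -> [set: set X] B -> stone_base A U -> stone_base B U ->
  exists C, [/\ [set: set X] C, stone_base C U &
    stone_base C `<=` stone_base A `&` stone_base B].
Proof.
move=> _ _ UA UB; exists (A `&` B); split => //.
  by have UF := ultra_setsP U; exact: filterI.
move=> V VAB; have VF := ultra_setsP V.
by split; apply: filterS VAB => x [].
Qed.

HB.instance Definition _ :=
  isBaseTopological.Build (ultrafilter X) stone_cover stone_join.

End StoneTopology.

(* Alias of T, so that open and closed refer to the topology having the
   G_delta subsets of T as a base. *)
Definition Gdelta_topology (T : Type) : Type := T.

Section GdeltaTopology.
Variable T : topologicalType.

Let Gdelta_cover :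
  \bigcup_(A in [set A : set T | Gdelta A]) (A : set (Gdelta_topology T)) =
  setT.
Proof.
rewrite -subTset => x _; exists setT => //=.
by apply: open_Gdelta; exact: openT.
Qed.

Let Gdelta_join (A B : set T) (x : Gdelta_topology T) :
    [set A | Gdelta A] A -> [set A | Gdelta A] B -> A x -> B x ->
  exists C : set T, [/\ [set A | Gdelta A] C, C x & C `<=` A `&` B].
Proof.
move=> [F oF AF] [G oG BG] Ax Bx; exists (A `&` B); split => //.
exists (fun n => F n `&` G n); first by move=> n; exact: openI.
by rewrite AF BG bigcapI.
Qed.

HB.instance Definition _ := Choice.on (Gdelta_topology T).
HB.instance Definition _ :=
  isBaseTopological.Build (Gdelta_topology T) Gdelta_cover Gdelta_join.

End GdeltaTopology.

Definition delta_closed (T : topologicalType) (S : set T) : Prop :=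
  closed (S : set (Gdelta_topology T)).

Definition lindelof (T : topologicalType) : Prop :=
  forall O : set (set T),
    (forall V, O V -> open V) -> \bigcup_(V in O) V = setT ->
  exists O' : set (set T),
    [/\ O' `<=` O, countable O' & \bigcup_(V in O') V = setT].

(* Main.v *)
(** Take X = N x P(N), with columns K_Y = N x {Y}, and let S be the set of
    free ultrafilters containing some column. The sets stone_base K_Y are
    disjoint and open, meet S, cover S and are uncountably many, so S is not
    Lindelof. An ultrafilter U determines a single subset Z of N by
    n \in Z <-> {(k, Y) | n \in Y} \in U; the countably many conditions fixing
    Z define a G_delta set containing U in which K_Z is the only column that an
    ultrafilter can contain. If U is free and outside S, then K_Z is not in U,
    and adding the open condition that K_Z is not a member gives a G_delta
    neighbourhood of U disjoint from S. Principal ultrafilters are isolated. *)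
Require Import Defs.
From mathcomp Require Import all_boot all_order all_algebra.
From mathcomp Require Import all_classical all_reals all_analysis.
From mathcomp Require Import borel_hierarchy.

Set Implicit Arguments.
Unset Strict Implicit.
Unset Printing Implicit Defensive.

Local Open Scope classical_set_scope.

Lemma open_stone_base (X : Type) (A : set X) : open (stone_base A).
Proof. by exists [set A] => //; rewrite bigcup_set1. Qed.

Lemma delta_openP (T : topologicalType) (S : set T) :
  (forall x, S x -> exists G : set T, [/\ Gdelta G, G x & G `<=` S]) ->
  open (S : set (Gdelta_topology T)).
Proof.
move=> SP; exists [set G : set T | Gdelta G /\ G `<=` S]; first by move=> G [].
apply/seteqP; split=> [x [G [_ GS] Gx]|x Sx]; first exact: GS.
by have [G [dG Gx GS]] := SP x Sx; exists G.
Qed.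

Lemma ultra_nonempty (X : Type) (U : ultrafilter X) (A : set X) :
  stone_base A U -> A !=set0.
Proof.
by move=> UA; have UF := ultra_setsP U; exact: filter_ex UA.
Qed.

Lemma ultraI (X : Type) (U : ultrafilter X) (A B : set X) :
  stone_base A U -> stone_base B U -> stone_base (A `&` B) U.
Proof. by move=> UA UB; have UF := ultra_setsP U; exact: filterI. Qed.

Lemma ultraVC (X : Type) (U : ultrafilter X) (A : set X) :
  stone_base A U \/ stone_base (~` A) U.
Proof. by have UF := ultra_setsP U; exact: in_ultra_setVsetC. Qed.

Lemma ultraC (X : Type) (U : ultrafilter X) (A : set X) :
  stone_base (~` A) U -> ~ stone_base A U.
Proof. by move=> UnA UA; have [x []] := ultra_nonempty (ultraI UA UnA). Qed.

(** Cantor's diagonal argument: [D] collects the codes under [g] of the sets that omit their own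
    code. *)
Lemma uncountable_set_nat : ~ countable [set: set nat].
Proof.
move=> /countable_injP[g ginj].
pose D : set nat := [set n | exists2 Y, g Y = n & ~ Y n].
have nD : ~ D (g D).
  move=> DD; case: (DD) => Y gY; suff -> : Y = D by [].
  by apply: ginj; rewrite ?in_setT.
by apply: (nD); exists D.
Qed.

Definition column (Y : set nat) : set (nat * set nat) := [set p | p.2 = Y].

(** Freeness is phrased through singletons because each [stone_base [set p]] is a basic open set. *)
Definition column_ultrafilters : set (ultrafilter (nat * set nat)) :=
  [set U | (exists Y, stone_base (column Y) U) /\
           forall p, ~ stone_base [set p] U].

Lemma column_inj (U : ultrafilter (nat * set nat)) (Y Z : set nat) :
  stone_base (column Y) U -> stone_base (column Z) U -> Y = Z.
Proof.
by move=> UY UZ; have [p [<- <-]] := ultra_nonempty (ultraI UY UZ).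
Qed.

Lemma column_ultrafilters_free : column_ultrafilters `<=` @free_ultrafilter _.
Proof.
by move=> U [_ Ufree] [p Up]; apply: (Ufree p); rewrite /stone_base /= Up => q.
Qed.

(** The cofinite filter on [nat], pushed into the column over [Y], extends to an ultrafilter; the
    tails [k < n] keep every singleton out of it. *)
Lemma column_ultrafilter_exists (Y : set nat) :
  exists2 U, column_ultrafilters U & stone_base (column Y) U.
Proof.
have PF : ProperFilter ((fun k => (k, Y)) @ \oo) by exact: fmap_proper_filter.
have [G [GU FG]] := ultraFilterLemma PF.
pose U := Ultrafilter GU.
have UY : stone_base (column Y) U by apply: FG => /=; exact: filterE.
exists U => //; split=> [|[k Z]]; first by exists Y.
apply: ultraC; apply: FG.
by apply: filterS (nbhs_infty_gt k) => n kn -[nk _]; rewrite nk ltnn in kn.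
Qed.

Lemma column_ultrafilters_delta_closed : delta_closed column_ultrafilters.
Proof.
rewrite /delta_closed -[column_ultrafilters]setCK closedC.
apply: delta_openP => U nSU.
have [[p Up]|Ufree] := pselect (exists p, stone_base [set p] U).
  exists (stone_base [set p]); split=> //.
    by apply: open_Gdelta; exact: open_stone_base.
  by move=> V Vp [_ /(_ p)].
pose Z : set nat := [set n | stone_base [set p | p.2 n] U].
pose D n : set (nat * set nat) := [set p | p.2 n <-> Z n].
(* [D n] contains whichever of [[set p | p.2 n]] and its complement belongs to [U]. *)
have UD n : stone_base (D n) U.
  have UF := ultra_setsP U.
  have [Zn|nZn] := pselect (Z n).
    by apply: filterS (Zn) => p pn.
  have [//|] := ultraVC U [set p | p.2 n].
  by apply: filterS => p npn.
have UnZ : stone_base (~` column Z) U.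
  have [UZ|//] := ultraVC U (column Z).
  by case: nSU; split=> [|p Up]; [exists Z|apply: Ufree; exists p].
exists (\bigcap_n (stone_base (D n) `&` stone_base (~` column Z))); split.
- exists (fun n => stone_base (D n) `&` stone_base (~` column Z)) => // n.
  by apply: openI; exact: open_stone_base.
- by move=> n _; split.
move=> V VD [[Y VY] _].
have VnZ : stone_base (~` column Z) V by have [] := VD 0%N I.
apply: (ultraC VnZ); suff <- : Y = Z by [].
(* A point of [D n] lying in the column over [Y] shows that [Y] and [Z] agree at [n]. *)
apply/seteqP; split=> n;
  have [[k m] [Dn <-]] := ultra_nonempty (ultraI (VD n I).1 VY);
  exact: Dn.1 || exact: Dn.2.
Qed.

Lemma column_ultrafilters_not_lindelof :
  ~ lindelof (set_type column_ultrafilters).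
Proof.
pose B Y : set (set_type column_ultrafilters) :=
  set_val @^-1` stone_base (column Y).
move=> /(_ (range B)) [||C [CB Ccount Ccover]].
- move=> _ [Y _ <-]; apply: open_comp; last exact: open_stone_base.
  by move=> U _; exact: initial_continuous.
- rewrite -subTset => U _.
  by have [[Y UY] _] := set_valP U; exists (B Y) => //; exists Y.
have Bex Y : exists U, B Y U.
  have [U SU UY] := column_ultrafilter_exists Y.
  by exists (exist _ U (mem_set SU)).
have Binj (Y Z : set nat) U : B Y U -> B Z U -> Y = Z by exact: column_inj.
have CE Y : C (B Y).
  have [U UY] := Bex Y.
  have [V CV VU] : (\bigcup_(V in C) V) U by rewrite Ccover.
  have [Z _ BZ] := CB V CV.
  by rewrite (Binj Y Z U) ?BZ.
have /countable_injP[g ginj] := Ccount.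
apply: uncountable_set_nat; apply/countable_injP; exists (g \o B) => Y Z _ _ gYZ.
have BYZ : B Y = B Z by apply: ginj; rewrite ?inE.
by have [U UY] := Bex Y; apply: (Binj Y Z U UY); rewrite -BYZ.
Qed.

Theorem corollary69 :
  exists (X : Type) (S : set (ultrafilter X)),
    [/\ S `<=` @free_ultrafilter X, delta_closed S & ~ lindelof (set_type S)].
Proof.
exists (nat * set nat)%type, column_ultrafilters; split.
- exact: column_ultrafilters_free.
- exact: column_ultrafilters_delta_closed.
- exact: column_ultrafilters_not_lindelof.
Qed.
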